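(* Let $n$ be odd, and consider a system of $n$ peers with an external source holding an $n$-bit input array, in which the fraction of Byzantine peers is bounded above by $\beta=(n-1)/(2n)$ (that is, at most $(n-1)/2$ peers may be Byzantine). For every algorithm $A\in\mathcal A(n-1,1)$, i.e. every randomized Monte-Carlo algorithm for Download with query complexity at most $n-1$ and time complexity at most one round (messages may be arbitrarily large), there is an adversarial strategy such that $A$ fails to learn all the input bits with probability at least $(1-e^{-1})/4$. This lower bound holds even in the broadcast communication model.
   Context: Model. There are $n$ peers forming a complete network and a trusted read-only external source storing an array $X=(b_1,\dots,b_n)\in\{0,1\}^n$; a query $\mathrm{Query}(i)$ returns $b_i$. A synchronous round consists of three sub-rounds: (1) each peer $v$ generates a private random string $R_v$ (independently of other peers) and sends a set of queries to the source; (2) the source answers all queries; (3) each peer sends messages to the other peers, delivered in the same round. In a one-round algorithm each peer then computes its output. In particular, in a one-round algorithm the set of indices queried by a nonfaulty peer $v$ is determined by $R_v$ alone. Point-to-point communication: a peer may send different messages to different peers. Broadcast communication: every peer, including a Byzantine one, must send the same message to all peers. Download problem: every nonfaulty peer must output all of $X$. The adversary chooses $X$, a set of Byzantine peers of size at most $\beta n$, and the (arbitrary) behaviour of the Byzantine peers. For positive integers $q,t$, $\mathcal A(q,t)$ is the class of all randomized Monte-Carlo algorithms (including deterministic ones) in which each nonfaulty peer queries at most $q$ bits and which terminate within $t$ rounds. The algorithm fails if some nonfaulty peer does not output $X$ correctly. *)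

(* Defs.v *)
From HB Require Import structures.
From mathcomp Require Export all_boot all_order all_algebra.
From mathcomp Require Export all_classical all_reals all_analysis.

Set Implicit Arguments.
Unset Strict Implicit.
Unset Printing Implicit Defensive.

Import Order.TTheory GRing.Theory Num.Theory.
Local Open Scope classical_set_scope.
Local Open Scope ring_scope.

Definition input (n : nat) := {ffun 'I_n -> bool}.

(* [Some b]: the bit was queried and its value is [b]; [None]: not queried. *)
Definition answers (n : nat) := {ffun 'I_n -> option bool}.

Definition answers_to (n : nat) (X : input n) (Q : {set 'I_n}) : answers n :=
  [ffun i => if i \in Q then Some (X i) else None].

(* A bit string of arbitrary length; [None] means that nothing is sent. *)
Definition message := option (seq bool).

(* Indexed by the sender. *)
Definition inbox (n : nat) := {ffun 'I_n -> message}.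

(* A one-round algorithm, peer by peer, as a function of the private random
   string in [Str]. No separate law is recorded: the strings are random
   variables, see [failure_prob]. Queries, messages and outputs range over
   countable types, so measurability is stated on fibres. *)
Record algorithm (n : nat) (dS : measure_display) (Str : measurableType dS) :=
  Algorithm {
    query : 'I_n -> Str -> {set 'I_n};
    send : 'I_n -> Str -> answers n -> 'I_n -> message;
    output : 'I_n -> Str -> answers n -> inbox n -> input n;
    measurable_query : forall v Q, measurable [set r | query v r = Q];
    measurable_send :
      forall v a w m, measurable [set r | send v r a w = m];
    measurable_output :
      forall v a i y, measurable [set r | output v r a i = y]
  }.

(* An adversarial strategy. The input and the Byzantine set are fixed before
   the strings are drawn. The messages of the Byzantine peers may depend
   jointly on the strings of all Byzantine peers, but not on the private
   strings of the nonfaulty ones. [byz_send] is only used at Byzantine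
   senders. *)
Record adversary (n : nat) (dS : measure_display) (Str : measurableType dS) :=
  Adversary {
    adv_input : input n;
    byz : {set 'I_n};
    byz_send : 'I_n -> n.-tuple Str -> 'I_n -> message;
    byz_send_local : forall u (r r' : n.-tuple Str),
      (forall v, v \in byz -> tnth r v = tnth r' v) ->
      byz_send u r = byz_send u r';
    measurable_byz_send :
      forall u w m, measurable [set r | byz_send u r w = m]
  }.

Variant comm_model := PointToPoint | Broadcast.

Definition allowed (c : comm_model) (n : nat) (v : 'I_n)
    (msg : 'I_n -> message) : Prop :=
  match c with
  | PointToPoint => True
  | Broadcast => forall w w', w != v -> w' != v -> msg w = msg w'
  end.

(* The class A(q, 1) in the communication model [c]. *)
Definition one_round_class (c : comm_model) (q n : nat)
    (dS : measure_display) (Str : measurableType dS) (A : algorithm n Str) : Prop :=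
  (forall v r, (#|query A v r| <= q)%N) /\
  (forall v r a, allowed c v (send A v r a)).

Definition admissible_adversary (R : realType) (c : comm_model) (beta : R)
    (n : nat) (dS : measure_display) (Str : measurableType dS)
    (adv : adversary n Str) : Prop :=
  #|byz adv|%:R <= beta * n%:R /\
  (forall u r, u \in byz adv -> allowed c u (byz_send adv u r)).

Section Execution.
Variables (n : nat) (dS : measure_display) (Str : measurableType dS).
Variables (A : algorithm n Str) (adv : adversary n Str).
Implicit Type r : n.-tuple Str.

Definition answers_got r (v : 'I_n) : answers n :=
  answers_to (adv_input adv) (query A v (tnth r v)).

Definition received r (v : 'I_n) : inbox n :=
  [ffun u => if u == v then None
             else if u \in byz adv then byz_send adv u r v
             else send A u (tnth r u) (answers_got r u) v].

Definition final_output r (v : 'I_n) : input n :=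
  output A v (tnth r v) (answers_got r v) (received r v).

Definition fails r : Prop :=
  exists2 v, v \notin byz adv & final_output r v <> adv_input adv.

End Execution.

Definition mutually_independent (R : realType) (d : measure_display)
    (T : measurableType d) (P : probability T R)
    (dS : measure_display) (Str : measurableType dS)
    (n : nat) (rand : 'I_n -> {RV P >-> Str}) : Prop :=
  forall (J : {set 'I_n}) (E : 'I_n -> set Str),
    (forall v, measurable (E v)) ->
    P (\bigcap_(v in [set` J]) (rand v @^-1` E v)) =
      (\prod_(v in J) P (rand v @^-1` E v))%E.

Definition failure_prob (R : realType) (d : measure_display)
    (T : measurableType d) (P : probability T R)
    (dS : measure_display) (Str : measurableType dS)
    (n : nat) (rand : 'I_n -> {RV P >-> Str})
    (A : algorithm n Str) (adv : adversary n Str) : \bar R :=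
  P [set t | fails A adv [tuple rand v t | v < n]].

(* Main.v *)
(* A peer that misses at least one index has miss probabilities summing to at
   least 1 over the indices, so some index [i] has miss probabilities summing to
   at least 1 over the peers; by independence, some peer misses [i] with
   probability at least 1 - 1/e. Let n = 2m + 1. The input is zero outside [i],
   where it holds a bit [b]; the Byzantine set [B] has size [m], and its members
   behave honestly except that they pretend that bit [i] is [~~ b]. If
   [v \notin B] misses [i], it has the same view against [(b, B)] and against
   [(~~ b, ~: (v |: B))], hence outputs a wrong array in one of the two cases.
   Averaging over all [(b, B)], with [v] the first peer that misses [i], some
   pair fails with probability at least (1 - 1/e) * (m + 1) / (2 n). *)
Require Import Defs.
From mathcomp Require Import all_boot all_order all_algebra.
From mathcomp Require Import all_classical all_reals all_analysis.
From mathcomp Require Import zify ring lra.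
Import Order.TTheory GRing.Theory Num.Theory.
Local Open Scope ring_scope.

Set Implicit Arguments.
Unset Strict Implicit.
Unset Printing Implicit Defensive.

(** * Measurability of discrete-valued maps through their fibres *)

Section FibreMeasurable.
Local Open Scope classical_set_scope.

Definition fibre_measurable (d : measure_display) (S : measurableType d)
    (C : Type) (f : S -> C) : Prop :=
  forall y, measurable [set s | f s = y].

Variables (d : measure_display) (S : measurableType d).

(** A fibre is the union, over the countably many intermediate values [c], of intersections of two
    fibres. The continuation [g] sees [s] again because a peer reuses its random string after
    reading the answers and messages. *)
Lemma fibre_measurable_bind (C : countType) (C' : Type) (f : S -> C)
    (g : C -> S -> C') :
  fibre_measurable f -> (forall c, fibre_measurable (g c)) ->
  fibre_measurable (fun s => g (f s) s).
Proof.
move=> mf mg y.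
have -> : [set s | g (f s) s = y] =
    \bigcup_c ([set s | f s = c] `&` [set s | g c s = y]).
  by apply/seteqP; split=> s /= => [gy|[c _ [/= -> //]]]; exists (f s).
apply: countable_bigcupT_measurable; first exact: countableP.
by move=> c; apply: measurableI; [exact: mf | exact: mg].
Qed.

Lemma fibre_measurable_cst (C : Type) (c : C) :
  fibre_measurable (fun _ : S => c).
Proof.
move=> y; have [->|ncy] := pselect (c = y).
  by rewrite (_ : mkset _ = setT) //; apply/seteqP; split.
by rewrite (_ : mkset _ = set0) //; apply/seteqP; split.
Qed.

Lemma fibre_measurable_post (C : countType) (C' : Type) (f : S -> C)
    (g : C -> C') : fibre_measurable f -> fibre_measurable (g \o f).
Proof.
move=> mf; apply: (@fibre_measurable_bind _ _ f (fun c _ => g c)) => // c.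
exact: fibre_measurable_cst.
Qed.

Lemma fibre_measurable_preimage (C : countType) (f : S -> C) (D : set C) :
  fibre_measurable f -> measurable (f @^-1` D).
Proof.
move=> mf.
have := @fibre_measurable_post C bool f (fun c => `[< D c >]) mf true.
by congr measurable; apply/seteqP; split=> s /= => /asboolP.
Qed.

Lemma fibre_measurable_ffun (I : finType) (C : choiceType) (F : I -> S -> C) :
  (forall i, fibre_measurable (F i)) ->
  fibre_measurable (fun s => [ffun i => F i s]).
Proof.
move=> mF y.
have -> : [set s | [ffun i => F i s] = y] = \bigcap_i [set s | F i s = y i].
  apply/seteqP; split=> s /= => [<- i _|Fy]; first by rewrite ffunE.
  by apply/ffunP => i; rewrite ffunE; exact: Fy.
by apply: fin_bigcap_measurable => // i _; exact: mF.
Qed.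

Lemma fibre_measurable_comp (d' : measure_display) (S' : measurableType d')
    (C : Type) (h : S' -> S) (f : S -> C) :
  measurable_fun setT h -> fibre_measurable f -> fibre_measurable (f \o h).
Proof. by move=> mh mf y; have := mh measurableT _ (mf y); rewrite setTI. Qed.

End FibreMeasurable.

(** * Real-valued probabilities of events *)

Section Probability.
Local Open Scope classical_set_scope.
Variables (R : realType) (d : measure_display) (T : measurableType d).
Variable P : probability T R.

Definition pr (E : set T) : R := fine (P E).

Lemma prE (E : set T) : measurable E -> (pr E)%:E = P E.
Proof. by move=> mE; rewrite /pr fineK // fin_num_measure. Qed.

Lemma pr_ge0 (E : set T) : 0 <= pr E.
Proof. exact/fine_ge0/measure_ge0. Qed.

Lemma pr_le (E F : set T) :
  measurable E -> measurable F -> E `<=` F -> pr E <= pr F.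
Proof.
by move=> mE mF EF; rewrite -lee_fin !prE //; apply: le_measure; rewrite ?inE.
Qed.

Lemma pr_cover (E F G : set T) :
  measurable E -> measurable F -> measurable G -> E `<=` F `|` G ->
  pr E <= pr F + pr G.
Proof.
move=> mE mF mG EFG; rewrite -lee_fin EFinD !prE //.
apply: le_trans (measureU2 _ mF mG).
by apply: le_measure; rewrite ?inE //; exact: measurableU.
Qed.

Lemma pr_partition (C : finType) (f : T -> C) (E : set T) :
  fibre_measurable f -> measurable E ->
  pr E = \sum_c pr (E `&` [set t | f t = c]).
Proof.
move=> mf mE; apply: EFin_inj; rewrite prE // -sumEFin.
have finC : finite_set [set: C] by exact: finite_finset.
have mEf c : measurable (E `&` [set t | f t = c]) by exact: measurableI.
under eq_bigr do rewrite prE //.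
have -> : P E = P (\bigcup_(c in [set: C]) (E `&` [set t | f t = c])).
  by congr (P _); apply/seteqP; split=> [t Et|t [c _ []]//]; exists (f t).
rewrite measure_fin_bigcup //.
- rewrite fsbig_finite //=.
  rewrite [RHS](perm_big (finmap.enum_fset (fset_set [set: C]))) //=.
  apply: uniq_perm; rewrite ?index_enum_uniq ?finmap.fset_uniq // => c.
  by rewrite mem_index_enum in_fset_set // mem_set.
- by move=> c c' _ _ [t [[_ /= <-] [_ /= <-]]].
Qed.

Lemma pr_setC (E : set T) : measurable E -> pr (~` E) = 1 - pr E.
Proof.
move=> mE; apply: EFin_inj.
by rewrite EFinB !prE ?probability_setC //; exact: measurableC.
Qed.

End Probability.

(** Each factor satisfies [1 - p v <= expR (- p v)], and the exponents add up to at most [-1]. *)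
Lemma one_minus_prod_ge (R : realType) (I : finType) (p : I -> R) :
  (forall v, 0 <= p v <= 1) -> 1 <= \sum_v p v ->
  1 - expR (- 1) <= 1 - \prod_v (1 - p v).
Proof.
move=> p01 p1; rewrite lerD2l lerN2.
apply: (@le_trans _ _ (\prod_v expR (- p v))).
  apply: ler_prod => v _; have /andP[_ pv1] := p01 v.
  by rewrite subr_ge0 pv1 expR_ge1Dx.
by rewrite -expR_sum ler_expR sumrN lerN2.
Qed.


(** * Measurability of failure, and the adversary that flips one bit *)

Section Execution.
Local Open Scope classical_set_scope.
Variables (n : nat) (dS : measure_display) (Str : measurableType dS).
Variable A : algorithm n Str.

Lemma fibre_measurable_answers_got (adv : adversary n Str) (v : 'I_n) :
  fibre_measurable (fun r => answers_got A adv r v).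
Proof.
apply: (fibre_measurable_post (f := query A v \o (tnth (T:=Str))^~ v)).
apply: fibre_measurable_comp; first exact: measurable_tnth.
exact: measurable_query.
Qed.

Lemma fibre_measurable_received (adv : adversary n Str) (v : 'I_n) :
  fibre_measurable (fun r => received A adv r v).
Proof.
apply: fibre_measurable_ffun => u.
have [_|_] := eqVneq u v; first exact: fibre_measurable_cst.
have [_|_] := boolP (u \in byz adv); first exact: measurable_byz_send.
apply: (fibre_measurable_bind (f := answers_got A adv ^~ u)
  (g := fun a r => send A u (tnth r u) a v)).
  exact: fibre_measurable_answers_got.
move=> a; apply: (fibre_measurable_comp (h := (tnth (T:=Str))^~ u)
  (f := fun s => send A u s a v)); first exact: measurable_tnth.
exact: measurable_send.
Qed.

Lemma fibre_measurable_final_output (adv : adversary n Str) (v : 'I_n) :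
  fibre_measurable (fun r => final_output A adv r v).
Proof.
apply: (fibre_measurable_bind (f := answers_got A adv ^~ v)
  (g := fun a r => output A v (tnth r v) a (received A adv r v))).
  exact: fibre_measurable_answers_got.
move=> a; apply: (fibre_measurable_bind (f := received A adv ^~ v)
  (g := fun i r => output A v (tnth r v) a i)).
  exact: fibre_measurable_received.
move=> i; apply: (fibre_measurable_comp (h := (tnth (T:=Str))^~ v)
  (f := fun s => output A v s a i)); first exact: measurable_tnth.
exact: measurable_output.
Qed.

Lemma measurable_fails (adv : adversary n Str) :
  measurable [set r | fails A adv r].
Proof.
have -> : [set r | fails A adv r] = \bigcup_(v in [set v | v \notin byz adv])
    ~` [set r | final_output A adv r v = adv_input adv].
  by apply/seteqP; split=> r /= [v vb Hv]; exists v.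
apply: fin_bigcup_measurable => [|v _]; first exact: finite_finset.
by apply: measurableC; exact: fibre_measurable_final_output.
Qed.

Variable i : 'I_n.

Definition single_bit (b : bool) : input n := [ffun j => (j == i) && b].

Definition honest_send (X : input n) (u : 'I_n) (r : n.-tuple Str) :
    'I_n -> message :=
  send A u (tnth r u) (answers_to X (query A u (tnth r u))).

(** The constant [None] outside [B] lets locality hold for every sender, since only the strings of
    peers in [B] are read. *)
Definition flip_send (b : bool) (B : {set 'I_n}) (u : 'I_n)
    (r : n.-tuple Str) : 'I_n -> message :=
  if u \in B then honest_send (single_bit (~~ b)) u r else fun=> None.

Lemma flip_send_local b (B : {set 'I_n}) (u : 'I_n) (r r' : n.-tuple Str) :
  (forall v, v \in B -> tnth r v = tnth r' v) ->
  flip_send b B u r = flip_send b B u r'.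
Proof.
rewrite /flip_send; case: ifP => // uB /(_ u uB) rr'.
by rewrite /honest_send rr'.
Qed.

Lemma measurable_flip_send b (B : {set 'I_n}) (u w : 'I_n) m :
  measurable [set r | flip_send b B u r w = m].
Proof.
rewrite /flip_send; have [_|_] := boolP (u \in B); last first.
  exact: (@fibre_measurable_cst _ (n.-tuple Str) _ (None : message) m).
pose h (s : Str) :=
  send A u s (answers_to (single_bit (~~ b)) (query A u s)) w.
apply: (@fibre_measurable_comp _ _ _ _ _ ((tnth (T:=Str))^~ u) h).
  exact: measurable_tnth.
apply: (fibre_measurable_bind (f := query A u)
  (g := fun Q s => send A u s (answers_to (single_bit (~~ b)) Q) w)).
  exact: measurable_query.
by move=> Q; exact: measurable_send.
Qed.

Definition flip_adversary (b : bool) (B : {set 'I_n}) : adversary n Str :=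
  Adversary (single_bit b) (@flip_send_local b B)
    (@measurable_flip_send b B).

Lemma answers_to_single_bit (b b' : bool) (Q : {set 'I_n}) :
  i \notin Q -> answers_to (single_bit b) Q = answers_to (single_bit b') Q.
Proof.
move=> iQ; apply/ffunP => j; rewrite !ffunE; case: ifP => // jQ.
by rewrite (_ : (j == i) = false) //; apply: contraNF iQ => /eqP <-.
Qed.

Definition mirror (v : 'I_n) (B : {set 'I_n}) : {set 'I_n} := ~: (v |: B).

(* The honest and the Byzantine senders exchange their roles, so each sender
   other than [v] sends the same message in both executions. *)
Lemma final_output_mirror (b : bool) (B : {set 'I_n}) (v : 'I_n)
    (r : n.-tuple Str) :
  v \notin B -> i \notin query A v (tnth r v) ->
  final_output A (flip_adversary b B) r v =
  final_output A (flip_adversary (~~ b) (mirror v B)) r v.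
Proof.
move=> vB iQ; rewrite /final_output.
have -> : answers_got A (flip_adversary b B) r v =
    answers_got A (flip_adversary (~~ b) (mirror v B)) r v.
  exact: answers_to_single_bit.
congr output; apply/ffunP => u; rewrite !ffunE /= /flip_send !inE.
by have [//|_ /=] := eqVneq u v; case: (u \in B); rewrite //= negbK.
Qed.

(** The common output of [v] cannot equal both inputs, which differ at [i]; and [v] is nonfaulty in
    both executions. *)
Lemma fails_or_mirror_fails (b : bool) (B : {set 'I_n}) (v : 'I_n)
    (r : n.-tuple Str) :
  v \notin B -> i \notin query A v (tnth r v) ->
  fails A (flip_adversary b B) r \/
  fails A (flip_adversary (~~ b) (mirror v B)) r.
Proof.
move=> vB iQ.
have [out_b|] := pselect
    (final_output A (flip_adversary b B) r v = single_bit b); last first.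
  by left; exists v.
right; exists v; first by rewrite /= /mirror !inE eqxx.
rewrite -final_output_mirror // out_b => /ffunP /(_ i).
by rewrite !ffunE eqxx; case: b {out_b}.
Qed.

End Execution.

(** * Double counting over Byzantine sets and their mirrors *)

Section Averaging.
Variables (R : realType) (d : measure_display) (T : measurableType d).
Variables (P : probability T R) (n m : nat).
Hypothesis n_odd : n = m.*2.+1.

(** A mirror of a mirror never contains [v], and off [v] complementing twice changes nothing. The
    boolean form matches the side condition produced by [reindex_onto]. *)
Lemma mirrorK (v : 'I_n) (B : {set 'I_n}) :
  (mirror v (mirror v B) == B) = (v \notin B).
Proof.
apply/eqP/idP => [<-|vB]; first by rewrite /mirror !inE eqxx.
apply/setP => u; rewrite !inE.
by have [->|_] := eqVneq u v; rewrite ?(negbTE vB) ?negbK.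
Qed.

Lemma card_mirror (v : 'I_n) (B : {set 'I_n}) :
  v \notin B -> (#|mirror v B| == m) = (#|B| == m).
Proof.
move=> vB; rewrite /mirror cardsCs finset.setCK card_ord cardsU1 vB.
(* The subtraction is truncated: for [m = 0] it gives 0 whatever the size of [B], and this bound is
   what forces [B] to be empty. *)
have : (#|B| < n)%N.
  have <- : #|v |: B| = #|B|.+1 by rewrite cardsU1 vB.
  by rewrite -[leqRHS](card_ord n) max_card.
by have := n_odd; lia.
Qed.

Lemma card_draws_avoiding (v : 'I_n) :
  #|[set B : {set 'I_n} | (v \notin B) && (#|B| == m)]%SET| = 'C(n.-1, m).
Proof.
have := cards_draws [set~ v]%SET m; rewrite cardsC1 card_ord => <-.
by apply: eq_card => B; rewrite !inE finset.subsetC finset.sub1set inE.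
Qed.

(** If all [F b B] with [#|B| = m] had probability below a quarter of that of [E], summing them
    would contradict the count of the sets [B] that avoid [first t], a proportion
    [(m + 1) / n > 1 / 2] of all sets of size [m]. *)
Lemma mirror_average (F : bool -> {set 'I_n} -> set T) (E : set T)
    (first : T -> 'I_n) :
  (forall b B, measurable (F b B)) -> measurable E ->
  fibre_measurable first ->
  (forall t b (B : {set 'I_n}), E t -> first t \notin B ->
    F b B t \/ F (~~ b) (mirror (first t) B) t) ->
  exists b (B : {set 'I_n}), #|B| = m /\ pr P E / 4 <= pr P (F b B).
Proof.
move=> mF mE mfirst FE; apply: contrapT => noF.
have small b (B : {set 'I_n}) : #|B| = m -> pr P (F b B) < pr P E / 4.
  by move=> Bm; rewrite ltNge; apply/negP => EF; apply: noF; exists b, B.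
(* On [W v] the peer is fixed, so the mirror map is a single involution of the sets of size [m]
   avoiding [v]. *)
pose W v := (E `&` [set t | first t = v])%classic.
have mW v : measurable (W v) by apply: measurableI => //; exact: mfirst.
pose f b v B := pr P (F b B `&` W v)%classic.
have cover v (B : {set 'I_n}) : v \notin B ->
    pr P (W v) <= f true v B + f false v (mirror v B).
  move=> vB; apply: pr_cover; [exact: mW| exact: measurableI..|].
  move=> t [/= Et tv]; subst v.
  by case: (FE t true B Et vB) => Ft; [left|right].
have lower v : pr P (W v) *+ 'C(n.-1, m) <=
    \sum_(B : {set 'I_n} | (v \notin B) && (#|B| == m))
      (f true v B + f false v B).
  rewrite big_split /=.
  (* Reindexing by the involution pairs [f true v B] with [f false v (mirror v B)], as [cover]
     requires. *)
  rewrite [X in _ <= _ + X](reindex_onto (mirror v) (mirror v)) /=; last first.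
    by move=> B /andP[vB _]; apply/eqP; rewrite mirrorK.
  rewrite [X in _ <= _ + X](eq_bigl
      (fun B : {set 'I_n} => (v \notin B) && (#|B| == m))); last first.
    move=> B; rewrite mirrorK andbC; have [vB|//] := boolP (v \notin B).
    by rewrite card_mirror // /mirror !inE eqxx.
  rewrite -big_split /= -(card_draws_avoiding v) -sumr_const.
  rewrite [X in X <= _](eq_bigl
      (fun B : {set 'I_n} => (v \notin B) && (#|B| == m))); last first.
    by move=> B; rewrite inE.
  by apply: ler_sum => B /andP[vB _]; exact: cover.
have upper b (B : {set 'I_n}) :
    \sum_(v | v \notin B) f b v B <= pr P (F b B).
  rewrite (pr_partition P mfirst (mF b B)).
  rewrite [leRHS](bigID (fun v => v \notin B)) /= -[leLHS]addr0.
  apply: lerD; last by apply: sumr_ge0 => v _; exact: pr_ge0.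
  apply: ler_sum => v _; apply: pr_le; [exact: measurableI| |].
    by apply: measurableI => //; exact: mfirst.
  by move=> t [Ft [_ tv]].
have : pr P E *+ 'C(n.-1, m) <= (pr P E / 4 *+ 2) *+ 'C(n, m).
  rewrite (pr_partition P mfirst mE) -sumrMnl.
  apply: le_trans (ler_sum _ (fun v _ => lower v)) _.
  rewrite (exchange_big_dep (fun B : {set 'I_n} => #|B| == m)) /=; last first.
    by move=> v B _ /andP[].
  have := card_draws 'I_n m; rewrite card_ord => <-.
  rewrite -sumr_const big_set /=.
  apply: ler_sum => B /eqP Bm.
  rewrite (eq_bigl (fun v => v \notin B)); last first.
    by move=> v; rewrite Bm eqxx andbT.
  rewrite big_split mulr2n -(pr_partition P mfirst mE).
  by apply: lerD; apply: le_trans (upper _ _) _; exact/ltW/small.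
(* The assumed strict bound gives positivity as soon as one set of size [m] exists. *)
have E_gt0 : 0 < pr P E.
  have [B] : exists B : {set 'I_n}, #|B| = m.
    have : (0 < 'C(n, m))%N by rewrite bin_gt0 n_odd; lia.
    have := card_draws 'I_n m; rewrite card_ord => <- /card_gt0P[B].
    by rewrite inE => /eqP; exists B.
  by move=> /(small true); have := pr_ge0 P (F true B); lra.
(* This identity reads [(2m + 1) * 'C(2m, m) = (m + 1) * 'C(2m + 1, m)], whence
   ['C(2m + 1, m) < 2 * 'C(2m, m)], against the inequality just summed. *)
have := mul_bin_down n m; rewrite n_odd (_ : m.*2.+1 - m = m.+1)%N; last lia.
have : (0 < 'C(m.*2.+1, m))%N by rewrite bin_gt0; lia.
rewrite /=; set c := 'C(_, _); set c' := 'C(_, _) => c0 cc'.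
have : (c < c'.*2)%N by nia.
rewrite -(ltr_nat R) -muln2 natrM -[_ *+ c']mulr_natr -[_ *+ c]mulr_natr.
by nra.
Qed.

End Averaging.

(** * An index that some peer is likely to miss *)

Section MissedBit.
Local Open Scope classical_set_scope.
Variables (R : realType) (n : nat) (d : measure_display) (T : measurableType d).
Variables (P : probability T R).
Variables (dS : measure_display) (Str : measurableType dS).
Variables (rand : 'I_n -> {RV P >-> Str}) (A : algorithm n Str).

Definition misses (i v : 'I_n) : set T :=
  [set t | i \notin query A v (rand v t)].

Lemma fibre_measurable_query_rand (v : 'I_n) :
  fibre_measurable (fun t => query A v (rand v t)).
Proof.
apply: fibre_measurable_comp; first exact: measurable_funPT.
exact: measurable_query.
Qed.

Lemma measurable_misses (i v : 'I_n) : measurable (misses i v).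
Proof.
exact: (fibre_measurable_preimage
  [set Q : {set 'I_n} | i \notin Q] (fibre_measurable_query_rand v)).
Qed.

Lemma measurable_someone_misses (i : 'I_n) : measurable (\bigcup_v misses i v).
Proof.
apply: fin_bigcup_measurable => [|v _]; first exact: finite_finset.
exact: measurable_misses.
Qed.

(** Selecting one missed index at each outcome partitions the whole space into events, the [i]-th of
    which lies inside [misses i v]. The query bound ensures that the selection never falls back on
    its default. *)
Lemma sum_pr_misses_ge1 (v : 'I_n) :
  (forall r, (#|query A v r| < n)%N) -> 1 <= \sum_i pr P (misses i v).
Proof.
move=> qA; pose f t := odflt v [pick i | i \notin query A v (rand v t)].
have mf : fibre_measurable f.
  exact: (fibre_measurable_post (fun Q : {set 'I_n} =>
    odflt v [pick i | i \notin Q]) (fibre_measurable_query_rand v)).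
have -> : 1 = pr P setT by rewrite /pr probability_setT.
rewrite (pr_partition P mf measurableT); apply: ler_sum => i _.
apply: pr_le; [by rewrite setTI; exact: mf | exact: measurable_misses |].
move=> t [_ /= <-]; rewrite /misses /f /=; case: pickP => //= all_queried.
have := qA (rand v t); rewrite (_ : query A v _ = [set: 'I_n]%SET).
  by rewrite cardsT card_ord ltnn.
by apply/setP => j; rewrite inE; have /negbFE := all_queried j.
Qed.

(** The double sum of miss probabilities is at least [n], so one of its [n] columns is at least
    1. *)
Lemma exists_missed_bit :
  (0 < n)%N -> (forall v r, (#|query A v r| < n)%N) ->
  exists i, 1 <= \sum_v pr P (misses i v).
Proof.
move=> n0 qA; apply: contrapT => noi.
have : \sum_(v < n) 1 <= \sum_v \sum_i pr P (misses i v).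
  by apply: ler_sum => v _; exact: sum_pr_misses_ge1.
rewrite exchange_big leNgt => /negP; apply; apply: ltr_sum.
  by apply/hasP; exists (Ordinal n0); rewrite ?mem_index_enum.
by move=> i _; rewrite ltNge; apply/negP => ?; apply: noi; exists i.
Qed.

Lemma pr_someone_misses (i : 'I_n) : mutually_independent rand ->
  1 <= \sum_v pr P (misses i v) ->
  1 - expR (- 1) <= pr P (\bigcup_v misses i v).
Proof.
move=> ind sum_ge1.
pose E v := [set s | i \in query A v s].
have mE v : measurable (E v).
  exact: (fibre_measurable_preimage
    [set Q : {set 'I_n} | i \in Q] (measurable_query A v)).
have missesE v : ~` misses i v = rand v @^-1` E v.
  apply/seteqP; split=> t /=; first by move/negP; rewrite negbK.
  by move=> iQ; apply/negP; rewrite negbK.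
(* The complement is written as an intersection over the full finite set of peers, the shape to
   which independence applies. *)
have -> : \bigcup_v misses i v =
    ~` (\bigcap_(v in [set` [set: 'I_n]%SET]) (rand v @^-1` E v)).
  rewrite setC_bigcap; apply/seteqP; split=> t [v _].
    by rewrite -[misses i v]setCK missesE => Ht; exists v => //=; rewrite inE.
  by rewrite -missesE setCK; exists v.
have mrE v : measurable (rand v @^-1` E v).
  by rewrite -missesE; apply: measurableC; exact: measurable_misses.
rewrite pr_setC; last first.
  by apply: fin_bigcap_measurable => //; exact: finite_finset.
have prmE v : P (rand v @^-1` E v) = (1 - pr P (misses i v))%:E.
  by rewrite -pr_setC ?missesE ?prE //; exact: measurable_misses.
rewrite {1}/pr ind // (eq_bigl xpredT); last by move=> v; rewrite inE.
under eq_bigr do rewrite prmE.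
rewrite prodEFin /=; apply: one_minus_prod_ge => // v.
rewrite pr_ge0 -lee_fin prE.
  by rewrite probability_le1 //; exact: measurable_misses.
exact: measurable_misses.
Qed.

End MissedBit.

Theorem theorem3p6 (R : realType) (n : nat) (hn : odd n)
    (c : comm_model)
    (d : measure_display) (T : measurableType d) (P : probability T R)
    (dS : measure_display) (Str : measurableType dS)
    (rand : 'I_n -> {RV P >-> Str}) (hrand : mutually_independent rand)
    (A : algorithm n Str) (hA : one_round_class c n.-1 A) :
  exists adv : adversary n Str,
    admissible_adversary c ((n%:R - 1) / (2 * n%:R) : R) adv /\
    (((1 - expR (- 1)) / 4)%:E <= failure_prob rand A adv)%E.
Proof.
case: hA => queries_le sends_ok.
have n0 : (0 < n)%N by case: (n) hn.
have nE : n = (n./2).*2.+1 by rewrite -[LHS]odd_double_half hn.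
have queries_lt v r : (#|query A v r| < n)%N.
  by have := queries_le v r; lia.
have [i sum_ge1] := exists_missed_bit rand n0 queries_lt.
pose draw t := [tuple rand v t | v < n].
have mdraw : measurable_fun setT draw.
  apply/measurable_fun_tnthP => v.
  rewrite (_ : _ \o _ = rand v); first exact: measurable_funPT.
  by apply/funext => t /=; rewrite tnth_mktuple.
pose F b B := [set t | fails A (flip_adversary A i b B) (draw t)]%classic.
have mF b B : measurable (F b B).
  have := mdraw measurableT _ (measurable_fails A (flip_adversary A i b B)).
  by rewrite setTI.
(* The default is taken only where nobody misses [i], that is, outside the event to which averaging
   is applied. *)
pose first t := odflt (Ordinal n0) [pick v | i \notin query A v (rand v t)].
have mfirst : fibre_measurable first.
  (* Factoring through the finite type of query profiles gives measurability. *)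
  pose g (q : {ffun 'I_n -> {set 'I_n}}) :=
    odflt (Ordinal n0) [pick v | i \notin q v].
  have := fibre_measurable_post g
    (fibre_measurable_ffun (fibre_measurable_query_rand rand A)).
  congr fibre_measurable; apply/funext => t; rewrite /g /first /=.
  by congr odflt; apply: eq_pick => v; rewrite ffunE.
have mE := measurable_someone_misses rand A i.
have [|b [B [Bm pF]]] := mirror_average P nE mF mE mfirst.
  move=> t b B [v _ missed] firstB.
  apply: fails_or_mirror_fails => //; rewrite tnth_mktuple.
  move: missed; rewrite /misses /first /=; case: pickP => //= all_queried.
  by rewrite all_queried.
exists (flip_adversary A i b B); split; last first.
  rewrite /failure_prob -[leRHS]prE ?lee_fin; last exact: mF.
  apply: le_trans pF; rewrite ler_pM2r ?invr_gt0 //.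
  exact: pr_someone_misses.
split=> [|u r uB] /=; last first.
  (* Byzantine messages are honest messages for another input, so they inherit the broadcast
     constraint from the algorithm. *)
  case: c sends_ok => //= sends_ok w w' wu w'u.
  by rewrite /flip_send uB; exact: sends_ok.
rewrite Bm; have n_neq0 : (n%:R : R) != 0 by rewrite pnatr_eq0 -lt0n.
have /(congr1 (fun k => k%:R : R)) : n = (2 * n./2 + 1)%N.
  by rewrite {1}nE -mul2n addn1.
rewrite natrD natrM => nR.
(* The allowed number of Byzantine peers is exactly [n./2], the size of [B]. *)
have -> : (n%:R - 1) / (2 * n%:R) * n%:R = (n%:R - 1) / 2 :> R by field.
by lra.
Qed.
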